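(* The only positive integers $n$ that are Munchausen numbers in base $10$, i.e. that satisfy $n = \theta_{10}(n)$, are $n = 1$ and $n = 3435$.
   Context: For a positive integer $n$ with decimal representation $[c_{m-1}, c_{m-2}, \ldots, c_0]_{10}$, meaning $0 \le c_i < 10$ for all $i \in \{0,\ldots,m-1\}$, $n = \sum_{i=0}^{m-1} c_i 10^i$, and no leading zeros ($c_{m-1} \neq 0$), define $\theta_{10}(n) = \sum_{i=0}^{m-1} c_i^{c_i}$, with the convention $0^0 = 1$. A positive integer $n$ is called a Munchausen number in base $10$ if and only if $n = \theta_{10}(n)$. *)

(* Defs.v *)
From mathcomp Require Import all_boot.

Set Implicit Arguments.
Unset Strict Implicit.
Unset Printing Implicit Defensive.

(* [decimal_repr n c]: the list c, least significant digit first
   (c = [:: c_0; ...; c_(m-1)]), is the decimal representation of n without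
   leading zeros; the condition c_(m-1) != 0 is [last 0 c != 0], which also excludes the
   empty list. *)
Definition decimal_repr (n : nat) (c : seq nat) : Prop :=
  [/\ forall i, i < size c -> nth 0 c i < 10,
      n = \sum_(i < size c) nth 0 c i * 10 ^ i
    & last 0 c != 0].

(* For 0 < n this list is the unique c with [decimal_repr n c]; see [digits10P] and
   [digits10_unique] below. *)
Definition digits10 (n : nat) : seq nat :=
  mkseq (fun i => n %/ 10 ^ i %% 10) (trunc_log 10 n).+1.

(* ssrnat's power satisfies 0 ^ 0 = 1. *)
Definition theta10 (n : nat) : nat := \sum_(c <- digits10 n) c ^ c.

Definition munchausen10 (n : nat) : Prop := n = theta10 n.

Lemma sum_digits10 n m :
  \sum_(i < m) (n %/ 10 ^ i %% 10) * 10 ^ i = n %% 10 ^ m.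
Proof.
elim: m => [|m IHm]; first by rewrite big_ord0 modn1.
rewrite big_ord_recr /= IHm.
have -> : n %/ 10 ^ m %% 10 = n %% 10 ^ m.+1 %/ 10 ^ m.
  by rewrite modn_divl -expnS.
have e : n %% 10 ^ m = n %% 10 ^ m.+1 %% 10 ^ m.
  by rewrite modn_dvdm // dvdn_exp2l.
by rewrite e addnC -divn_eq.
Qed.

Lemma digits10P n : 0 < n -> decimal_repr n (digits10 n).
Proof.
move=> n_gt0; have /andP[lo hi] := trunc_log_bounds (isT : 1 < 10) n_gt0.
rewrite /decimal_repr size_mkseq; split.
- by move=> i ltin; rewrite nth_mkseq // ltn_mod.
- rewrite -[LHS](modn_small hi) -sum_digits10.
  by apply: eq_bigr => i _; rewrite nth_mkseq.
- rewrite (last_nth 0) size_mkseq /= -[nth _ _ _]/(nth 0 (digits10 n) _).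
  rewrite nth_mkseq // modn_small;
    last by rewrite ltn_divLR ?expn_gt0 // -expnS.
  by rewrite -lt0n divn_gt0 ?expn_gt0.
Qed.

Lemma decimal_repr_gt0 n c : decimal_repr n c -> 0 < n.
Proof.
case=> _ ->; case/lastP: c => [//|s y]; rewrite last_rcons size_rcons -lt0n.
move=> y_gt0; rewrite big_ord_recr /= nth_rcons ltnn eqxx addn_gt0.
by rewrite muln_gt0 expn_gt0 y_gt0 orbT.
Qed.

Lemma digits10_unique n c : decimal_repr n c -> c = digits10 n.
Proof.
have inj c1 : forall c2 m, decimal_repr m c1 -> decimal_repr m c2 -> c1 = c2.
  have step x s m : decimal_repr m (x :: s) ->
      [/\ x = m %% 10, \sum_(i < size s) nth 0 s i * 10 ^ i = m %/ 10
        & s != [::] -> decimal_repr (m %/ 10) s].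
    case=> lt10 -> lastN0.
    have x10 : x < 10 by exact: (lt10 0).
    have -> : \sum_(i < size (x :: s)) nth 0 (x :: s) i * 10 ^ i
        = (\sum_(i < size s) nth 0 s i * 10 ^ i) * 10 + x.
      rewrite big_ord_recl /= muln1 addnC big_distrl /=; congr (_ + _).
      by apply: eq_bigr => i _; rewrite -mulnA -expnSr.
    have d : ((\sum_(i < size s) nth 0 s i * 10 ^ i) * 10 + x) %/ 10
        = \sum_(i < size s) nth 0 s i * 10 ^ i.
      by rewrite divnMDl // divn_small // addn0.
    split; first by rewrite modnMDl modn_small.
      by rewrite d.
    move=> sN0; split=> [i lti||]; first exact: (lt10 i.+1).
      exact: d.
    by case: s sN0 lastN0 {lt10 d}.
  elim: c1 => [|x s IHs] [|y t] m H1 H2 //; try by case: H1 => [_ _ /=].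
    by case: H2 => [_ _ /=].
  have [-> ds rs] := step _ _ _ H1; have [-> dt rt] := step _ _ _ H2.
  congr (_ :: _); case: (eqVneq s [::]) => [s0|sN0].
    case: (eqVneq t [::]) => [->|tN0]; first by [].
    by have := decimal_repr_gt0 (rt tN0); rewrite -ds s0 big_ord0.
  case: (eqVneq t [::]) => [t0|tN0].
    by have := decimal_repr_gt0 (rs sN0); rewrite -dt t0 big_ord0.
  by apply: IHs (rs sN0) (rt tN0).
move=> H; apply: (inj _ _ n H).
exact/digits10P/(decimal_repr_gt0 H).
Qed.

(* Main.v *)
Require Import Defs.
From Stdlib Require Import NArith.
From mathcomp Require Import all_boot.
From mathcomp Require Import zify.

Set Implicit Arguments.
Unset Strict Implicit.
Unset Printing Implicit Defensive.

(** A number with [m] digits has [theta10] at most [m * 9 ^ 9], which forces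
    [m <= 10].  The value of [theta10] depends only on the multiset of digits, so
    it suffices to enumerate, for each [m], the multisets of [m] digits and to
    compare each one with the digits of its own [theta10].  Choosing the large
    digits first, almost all multisets are discarded early because the sum cannot
    end up between [10 ^ m.-1] and [10 ^ m]. *)

(** Binary [N] instead of unary [nat] lets [vm_compute] handle values such as [9 ^ 9]. *)
Definition self_power (d : nat) : N := N.pow (N.of_nat d) (N.of_nat d).

(** Multiset comparison by removal: when [s] has [k] elements, success means that they are the [k]
    lowest digits of [S] in some order. *)
Fixpoint digits_in (s : seq nat) (k : nat) (S : N) : bool :=
  if k is k'.+1 then
    let (q, r) := N.div_eucl S 10 in
    let c := N.to_nat r in
    (c \in s) && digits_in (rem c s) k' q
  else true.

(* [ds] lists the digits still available in decreasing order, [r] is the number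
   of digits still to be chosen, [s] those already chosen and [S] the sum of
   their self-powers. *)
Fixpoint search (lo hi : N) (m : nat) (ds : seq nat) :
    nat -> N -> seq nat -> seq N :=
  match ds with
  | [::] => fun r S s => if digits_in s m S then [:: S] else [::]
  | d :: ds' =>
    let p := self_power d in
    fix aux r S s :=
      if N.ltb (N.add S (N.mul (N.of_nat r) p)) lo || N.leb hi S then [::]
      else if r is r'.+1 then
        aux r' (N.add S p) (d :: s) ++ search lo hi m ds' r S s
      else if digits_in s m S then [:: S] else [::]
  end.

Definition candidates (m : nat) : seq N :=
  search (N.pow 10 (N.of_nat m.-1)) (N.pow 10 (N.of_nat m)) m (rev (iota 0 10))
    m 0%num [::].

Lemma candidates_upto10 :
  flatten [seq candidates m | m <- iota 1 10] = [:: 1%num; 3435%num].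
Proof. by vm_compute. Qed.

Lemma to_nat_expn a k : N.to_nat (N.pow a (N.of_nat k)) = N.to_nat a ^ k.
Proof. lia. Qed.

Lemma to_nat_self_power d : N.to_nat (self_power d) = d ^ d.
Proof. by rewrite to_nat_expn Nnat.Nat2N.id. Qed.

Lemma digits_inP k s S :
  perm_eq s (mkseq (fun i => N.to_nat S %/ 10 ^ i %% 10) k) ->
  digits_in s k S.
Proof.
elim: k s S => [//|k IHk] s S.
rewrite /=; have := N.div_eucl_spec S 10; have := N.mod_lt S 10.
rewrite /N.modulo; case: N.div_eucl => q r lt_r SE.
have {}SE : S = N.add (N.mul 10 q) r by [].
have {}lt_r : N.lt r 10 by apply: lt_r.
have -> : mkseq (fun i => N.to_nat S %/ 10 ^ i %% 10) k.+1 =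
    N.to_nat r :: mkseq (fun i => N.to_nat q %/ 10 ^ i %% 10) k.
  rewrite /mkseq /= divn1; congr (_ :: _); first by lia.
  (* Digit [i.+1] of [S] is digit [i] of its quotient [q] by 10. *)
  rewrite -[in LHS](addn0 1) iotaDl -map_comp; apply: eq_map => i /=.
  by rewrite add1n expnS divnMA; congr (_ %/ _ %% _); lia.
move=> pe.
have cs : N.to_nat r \in s by rewrite (perm_mem pe) mem_head.
rewrite cs; apply: IHk.
by rewrite -(perm_cons (N.to_nat r)) -(permPl (perm_to_rem cs)).
Qed.

Lemma leq_self_power c d : c <= d -> c ^ c <= d ^ d.
Proof.
(* At [c = 0] the left side is [0 ^ 0 = 1]; otherwise compare both sides with [d ^ c]. *)
case: c => [|c] lecd; first by rewrite expn_gt0; case: d lecd.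
by apply: (@leq_trans (d ^ c.+1)); rewrite ?leq_exp2r ?leq_pexp2l //; lia.
Qed.

Lemma sum_self_power_le s d :
  all (leq^~ d) s -> \sum_(c <- s) c ^ c <= size s * d ^ d.
Proof.
elim: s => [|c s IHs] /=; first by rewrite big_nil.
by case/andP=> cd sd; rewrite big_cons mulSn leq_add ?leq_self_power ?IHs.
Qed.

(** Invariant along one branch: [s] is chosen, [t] is still to come, and together they are the
    digits of [n]. Taking [d] while it occurs in [t] and dropping it afterwards is never pruned and
    ends at [n]. *)
Lemma search_complete lo hi m ds n s t S :
  sorted gtn ds -> all (mem ds) t ->
  perm_eq (s ++ t) (mkseq (fun i => n %/ 10 ^ i %% 10) m) ->
  n = \sum_(c <- s ++ t) c ^ c -> N.to_nat lo <= n < N.to_nat hi ->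
  N.to_nat S = \sum_(c <- s) c ^ c ->
  N.of_nat n \in search lo hi m ds (size t) S s.
Proof.
move=> + + + + bnd.
have leaf s' S' : perm_eq s' (mkseq (fun i => n %/ 10 ^ i %% 10) m) ->
    n = \sum_(c <- s') c ^ c -> N.to_nat S' = \sum_(c <- s') c ^ c ->
    N.of_nat n \in if digits_in s' m S' then [:: S'] else [::].
  move=> pe nE SE; have {}SE : N.to_nat S' = n by rewrite nE.
  by rewrite digits_inP ?SE // inE; apply/eqP; lia.
elim: ds s t S => [|d ds IHds] s t S.
  by case: t => [|c t] //= _ _; rewrite cats0; apply: leaf.
move=> dsd; move rE: (size t) => r; elim: r s t S rE => [|r IHr] s t S rE tds pe nE SE.
  move: pe nE; rewrite (size0nil rE) cats0 => pe nE.
  rewrite /=; case: ifP => [|_]; last exact: leaf.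
  by lia.
have tled : all (leq^~ d) t.
  apply: sub_all tds => c; rewrite /= inE => /predU1P[->//|cds].
  have gt_trans : transitive gtn by move=> a b c0 /= ? ?; lia.
  have := order_path_min gt_trans dsd.
  by move/allP/(_ _ cds) => /=; lia.
have := sum_self_power_le tled; rewrite rE => tsum.
move: (nE); rewrite big_cat /= -SE => nE'.
(* One unfolding of the inner fixpoint, with [aux] folded back into [search] on [d :: ds]. *)
rewrite -[X in _ \in X]/(
    if N.ltb (N.add S (N.mul (N.of_nat r.+1) (self_power d))) lo || N.leb hi S
    then [::]
    else search lo hi m (d :: ds) r (N.add S (self_power d)) (d :: s) ++
         search lo hi m ds r.+1 S s).
(* The digits left are at most [d], so [n] lies between [S] and [S + r.+1 * d ^ d] and neither
   pruning test fires. *)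
case: ifP => [|_].
  have := to_nat_self_power d.
  move: (d ^ d) tsum => p; move: (self_power d) => P; nia.
rewrite mem_cat; apply/orP; case: (boolP (d \in t)) => [dt|dNt]; [left|right].
  have pt := perm_to_rem dt.
  have pst : perm_eq (s ++ t) ((d :: s) ++ rem d t).
    by rewrite (permPl (perm_cat (perm_refl s) pt)) -cat1s perm_catCA.
  apply: (IHr _ (rem d t)).
  - by rewrite size_rem // rE.
  - by apply/allP => c /mem_rem /(allP tds).
  - by rewrite -(permPl pst).
  - by rewrite -(perm_big _ pst).
  - rewrite big_cons -SE; have := to_nat_self_power d; lia.
rewrite -rE; apply: IHds => //; first exact: path_sorted dsd.
apply/allP => c ct; have := allP tds _ ct; rewrite /= inE.
by case/predU1P => // cd; rewrite -cd ct in dNt.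
Qed.

(** As [9 ^ 8 <= 10 ^ 8], it suffices that [k.+1 * 9 < 10 ^ (k - 8)]; at [k = 10] this is
    [99 < 100]. *)
Lemma mul_9exp9_lt_10exp k : 10 <= k -> k.+1 * 9 ^ 9 < 10 ^ k.
Proof.
move=> k10.
have k9 : k.+1 * 9 < 10 ^ (k - 8).
  have [j ->] : exists j, k = 10 + j by exists (k - 10); lia.
  rewrite -addnBAC //; elim: j => [//|j IHj].
  by rewrite addnS expnS; move: (10 ^ _) IHj => x; lia.
rewrite expnS mulnA.
have -> : 10 ^ k = 10 ^ (k - 8) * 10 ^ 8 by rewrite -expnD subnK //; lia.
apply: (@leq_ltn_trans (k.+1 * 9 * 10 ^ 8)).
  by rewrite leq_mul2l leq_exp2r ?orbT.
by rewrite ltn_mul2r expn_gt0.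
Qed.

(** With [k = trunc_log 10 n] there are [k.+1] digits, whence [10 ^ k <= n <= k.+1 * 9 ^ 9]. *)
Lemma trunc_log_munchausen n : 0 < n -> munchausen10 n -> trunc_log 10 n < 10.
Proof.
move=> n_gt0 nE; have /andP[lo _] := trunc_log_bounds (isT : 1 < 10) n_gt0.
rewrite ltnNge; apply/negP => /mul_9exp9_lt_10exp.
rewrite ltnNge => /negP; apply; apply: (leq_trans lo).
have le9 : all (leq^~ 9) (digits10 n).
  by apply/allP => _ /mapP[i _ ->]; rewrite -ltnS ltn_mod.
by rewrite {1}nE; move: (sum_self_power_le le9); rewrite size_mkseq.
Qed.

Lemma munchausen_candidate n :
  0 < n -> munchausen10 n -> N.of_nat n \in candidates (trunc_log 10 n).+1.
Proof.
move=> n_gt0 nE; have bnd := trunc_log_bounds (isT : 1 < 10) n_gt0.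
rewrite /candidates; set m := (trunc_log 10 n).+1.
have <- : size (digits10 n) = m by rewrite size_mkseq.
apply: search_complete; rewrite ?size_mkseq ?big_nil ?to_nat_expn //.
apply/allP => _ /mapP[i _ ->].
by rewrite -[mem _ _]/(_ \in rev (iota 0 10)) mem_rev mem_iota ltn_mod.
Qed.

Theorem mainTheorem2 (n : nat) (n_gt0 : 0 < n) :
  munchausen10 n <-> n = 1 \/ n = 3435.
Proof.
split=> [nE|].
  have : N.of_nat n \in flatten [seq candidates m | m <- iota 1 10].
    apply/flattenP; exists (candidates (trunc_log 10 n).+1).
      by apply: map_f; rewrite mem_iota /= add1n ltnS trunc_log_munchausen.
    exact: munchausen_candidate.
  rewrite candidates_upto10 !inE => /orP[]/eqP nN; [left|right];
    by rewrite -(Nnat.Nat2N.id n) nN.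
rewrite /munchausen10 /theta10 => -[]->.
  by rewrite -(@digits10_unique 1 [:: 1]) ?big_seq1 //; split => // [[|[]]|]; rewrite ?big_ord1.
(* Least significant digit first; the sum is [3125 + 27 + 256 + 27]. *)
rewrite -(@digits10_unique 3435 [:: 5; 3; 4; 3]); first by rewrite unlock.
by split=> [[|[|[|[|]]]]||] //; rewrite !big_ord_recr big_ord0.
Qed.
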